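(* Let $r\in\mathbb{R}$, $r\ge 1$, and let $C_r$ be the number of connected components of $\overline{\sigma_{-r}(\mathbb{N})}$. Then $C_r\ne 4$.
   Context: For real $r\ge 1$ and a positive integer $n$, $\sigma_{-r}(n)=\sum_{d\mid n} d^{-r}$, the sum being over positive divisors of $n$. $\overline{\sigma_{-r}(\mathbb{N})}$ is the topological closure in $\mathbb{R}$ of the range $\{\sigma_{-r}(n): n\in\mathbb{N}\}$, where $\mathbb{N}=\{1,2,\dots\}$. *)

(* Defs.v *)
From mathcomp Require Import all_boot all_order all_algebra.
From mathcomp Require Import all_classical all_reals all_analysis.
Set Implicit Arguments.
Unset Strict Implicit.
Unset Printing Implicit Defensive.
Import Order.TTheory GRing.Theory Num.Theory.
Import numFieldNormedType.Exports.
Local Open Scope classical_set_scope.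
Local Open Scope ring_scope.

(* [sigma_neg r n] is sigma_{-r}(n), for n > 0. *)
Definition sigma_neg (R : realType) (r : R) (n : nat) : R :=
  \sum_(d <- divisors n) d%:R `^ (- r).

(* The arguments are the positive integers: sigma_neg r 0 = 0 is excluded. *)
Definition sigma_neg_range (R : realType) (r : R) : set R :=
  [set sigma_neg r n | n in [set n : nat | (0 < n)%N]].

(* [connected_component A x] is empty when x is outside A, hence the
   restriction to x in A. *)
Definition components (T : topologicalType) (A : set T) : set (set T) :=
  [set connected_component A x | x in A].

(* Main.v *)
Require Import Defs.
From mathcomp Require Import all_boot all_order all_algebra.
From mathcomp Require Import all_classical all_reals all_analysis.
From mathcomp Require Import zify ring lra.
Import Order.TTheory GRing.Theory Num.Theory.
Import numFieldNormedType.Exports.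
Local Open Scope classical_set_scope.
Local Open Scope ring_scope.
Set Implicit Arguments.
Unset Strict Implicit.
Unset Printing Implicit Defensive.

(** For a prime p and x = p^-r, the divisor sum of p^a is the geometric sum
    1 + x + ... + x^a, and the divisor sum is multiplicative.  Its range is
    therefore a product of discrete sets, one for each prime, and the question
    is which of the gaps between consecutive geometric sums are filled by the
    contributions of the other primes.  The powers of p leave no gap when the
    primes above p satisfy the filling condition
    1 + p^-r <= prod_(q > p) 1/(1 - q^-r), here tail_fills.

    The number of components jumps over 4 when the filling condition fails at
    the prime 5.

    - If it holds at 5 and r <= 7/3, it holds at all larger primes.  A greedy
      algorithm (greedy_step, rough_approx_below) then shows that the 5-rough
      integers, the odd multiples of 3 and the even integers each have divisor
      sums with a connected closure, so there are at most three components
      (components_le3).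

    - If it fails at 5, the interval below 1 + 5^-r is missing, and so is its
      multiple by 1 + 2^-r, along with the gaps below 1 + 3^-r and 1 + 2^-r.
      There are at least five components (components_ge5).  This uses r >= 2,
      which follows from the failure because the condition holds at 5 for
      r <= 2 (tail_fills5).  For r > 7/3 it does fail: the divisors d > 1 of a
      6-rough integer are at least 7 and coprime to 30, and the sum of
      (5/d)^(7/3) over all such d is below 1 (sigma_rough6_le).

    The filling condition at a prime p follows from the inequality
    sum_(q > p) (p/q)^s >= 1 for some s >= r, q running over primes.  For p = 7
    take s = 7/3, where the margin is small; for p >= 11 take s = 3.  Explicit
    lists of primes settle p < 4096; beyond that, Chebyshev's estimate for
    central binomial coefficients gives 64 primes in (p, 4p]
    (many_primes_window). *)

(** * Many primes between n and 4n *)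

Section Primes.
Local Open Scope nat_scope.

Lemma central_binomial_ge n : 0 < n -> 4 ^ n <= 2 * n * 'C(2 * n, n).
Proof.
elim: n => // -[_ _|n /(_ isT) IHn _]; first by [].
have e1 : n.+2 * 'C(2 * n.+2, n.+2) = 2 * (2 * n.+1).+1 * 'C(2 * n.+1, n.+1).
  have h1 := mul_bin_diag (2 * n.+1).+2 n.+1.
  have h2 := mul_bin_down (2 * n.+1).+1 n.+1.
  rewrite (_ : 2 * n.+2 = (2 * n.+1).+2) /= in h1 h2 *; last lia.
  rewrite (_ : (2 * n.+1).+1 - n.+1 = n.+2) in h2; last lia.
  nia.
rewrite expnS; nia.
Qed.

Lemma sum_indicator_ltn a m s : \sum_(a <= k < m) (k < s) <= s - a.
Proof.
suff: \sum_(a <= k < m) (k < s) <= minn m s - a by lia.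
elim: m => [|m IHm]; first by rewrite big_geq.
have [am|ma] := leqP a m; last by rewrite big_geq.
rewrite big_nat_recr //=; case: ltnP => ms; lia.
Qed.

(** The argument of Erdos for n = 2m+1: the primes in [m+2, 2m+1] all divide
    the binomial coefficient C(2m+1, m), which is at most 4^m because it occurs
    twice in the expansion of (1+1)^(2m+1); the primes up to m+1 are handled by
    induction.  An even n > 2 adds no prime. *)
Lemma primorial_le n : \prod_(0 <= p < n.+1 | prime p) p <= 4 ^ n.
Proof.
elim/ltn_ind: n => -[_|[_|[_|n IHn]]].
- by rewrite unlock.
- by rewrite unlock.
- by rewrite unlock.
rewrite big_mkcond big_nat_recr //= -big_mkcond /=.
case: ifP => pr; last first.
  rewrite muln1 (leq_trans (IHn n.+2 _)) //; by rewrite leq_exp2l.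
have [m Em] : exists m, n.+3 = m.*2.+1.
  exists (n.+3)./2; rewrite -[LHS]odd_double_half.
  by case/even_prime: pr => // ->.
have m_gt0 : 0 < m by lia.
have mn : m < n.+2 by lia.
have -> : \prod_(0 <= p < n.+3 | prime p) p * n.+3
        = \prod_(0 <= p < m.+2 | prime p) p * \prod_(m.+2 <= p < m.*2.+2 |
          prime p) p.
  rewrite -big_cat_nat /=; [|lia..].
  rewrite [RHS]big_mkcond /= -Em big_nat_recr //= -big_mkcond /= pr;
    congr (_ * _).
have -> : 4 ^ n.+3 = 4 ^ m.+1 * 4 ^ m by rewrite -expnD; congr (_ ^ _); lia.
apply: leq_mul; first exact: IHn.
have binle : 'C(m.*2.+1, m) <= 4 ^ m.
  have e : \sum_(i < m.*2.+2) 'C(m.*2.+1, i) = 2 ^ m.*2.+1.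
    rewrite (expnDn 1 1) ; apply: eq_bigr => i _; by rewrite !exp1n !muln1.
  have : 'C(m.*2.+1, m) + 'C(m.*2.+1, m.+1) <= 2 ^ m.*2.+1.
    have i1 : m < m.*2.+2 by lia.
    have i2 : m.+1 < m.*2.+2 by lia.
    rewrite -e (bigD1 (Ordinal i1)) //= leq_add2l (bigD1 (Ordinal i2))
      ?leq_addr //=.
    by rewrite -val_eqE /=; lia.
  have <- : 'C(m.*2.+1, m) = 'C(m.*2.+1, m.+1).
    by rewrite -(bin_sub (n := m.*2.+1) (m := m.+1)) ; [congr 'C(_, _);
      lia|lia].
  rewrite expnS -mul2n expnM (_ : 2 ^ 2 = 4) //; lia.
apply: leq_trans binle; apply: dvdn_leq; first by rewrite bin_gt0; lia.
have cop : coprime (\prod_(m.+2 <= p < m.*2.+2 | prime p) p) (m.+1`! * m`!).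
  rewrite big_nat_cond coprime_sym.
  elim/big_ind : _ => [|x y hx hy|p]; first exact: coprimen1.
    by rewrite coprimeMr hx.
  case/andP => /andP[p1 p2] pp; rewrite coprime_sym prime_coprime //.
  have fact_le k : (p %| k`!) -> p <= k.
    elim: k => [|k IHk]; first by rewrite dvdn1 => /eqP p_1; move: pp;
      rewrite p_1.
    rewrite factS Euclid_dvdM // => /orP[/dvdn_leq -> //|/IHk]; lia.
  by rewrite Euclid_dvdM //; apply/negP => /orP[] /fact_le; lia.
have binf : 'C(m.*2.+1, m) * (m.+1`! * m`!) = m.*2.+1`!.
  rewrite -(@bin_fact m.*2.+1 m); last lia.
  by rewrite (_ : m.*2.+1 - m = m.+1); [rewrite mulnCA (mulnC m`!)|lia]; lia.
rewrite -(Gauss_dvdl _ cop) binf.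
have -> : m.*2.+1`! = m.+1`! * \prod_(m.+2 <= p < m.*2.+2) p.
  rewrite !fact_prod -big_cat_nat //=; lia.
apply: dvdn_mull.
rewrite big_mkcond /=; elim/big_rec2: _ => // i x y _ xy.
by case: ifP => _; [apply: dvdn_mul|rewrite mul1n dvdn_mull].
Qed.

(** By Legendre's formula the exponent of p in C(2n, n) is a sum of terms
    floor(2n/p^k) - 2 floor(n/p^k), each 0 or 1, and 0 as soon as p^k > 2n. *)
Lemma pfactor_central_binomial p n : prime p -> 0 < n ->
  p ^ logn p 'C(2 * n, n) <= 2 * n.
Proof.
move=> pp n0; have p1 := prime_gt1 pp.
have n20 : 0 < 2 * n by lia.
apply: leq_trans (trunc_logP p1 n20); rewrite leq_exp2l //.
have e : logn p 'C(2 * n, n) + 2 * logn p n`! = logn p (2 * n)`!.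
  rewrite -(@bin_fact (2 * n) n); last lia.
  rewrite (_ : 2 * n - n = n); last lia.
  by rewrite !lognM ?muln_gt0 ?fact_gt0 ?bin_gt0 //; lia.
have e1 : logn p n`! = \sum_(1 <= k < (2 * n).+1) n %/ p ^ k.
  rewrite logn_fact // (@big_cat_nat _ _ _ n.+1 1 (2 * n).+1) //=; last lia.
  rewrite [X in _ + X]big1_seq ?addn0 // => k;
    rewrite mem_index_iota => /andP[_ /andP[k1 k2]].
  by rewrite divn_small // (leq_trans k1) // ltnW // ltn_expl.
rewrite e1 logn_fact // big_distrr /= in e.
have : \sum_(1 <= k < (2 * n).+1) (2 * n) %/ p ^ k <=
   \sum_(1 <= k < (2 * n).+1) 2 * (n %/ p ^ k) + \sum_(1 <= k < (2 * n).+1) (k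
     <= trunc_log p (2 * n)).
  rewrite -big_split /=; apply: leq_sum => k _.
  have pk : 0 < p ^ k by rewrite expn_gt0; lia.
  case: (leqP k (trunc_log p (2 * n))) => hk.
    have h : (2 * n) %/ p ^ k < 2 * (n %/ p ^ k) + 2.
      by rewrite ltn_divLR //; have := ltn_ceil n pk; nia.
    by move: h; rewrite !addnS !addn0 ltnS.
  rewrite divn_small // ltnNge; apply/negP => h.
  by have := trunc_log_max p1 h; lia.
rewrite -e addnC leq_add2l => /leq_trans; apply.
have := @sum_indicator_ltn 1 (2 * n).+1 (trunc_log p (2 * n)).+1.
by rewrite subn1.
Qed.

(** Factor C(4n, 2n), which is at least 16^n / 4n.  Primes below s contribute at
    most 4n each; primes between s and n occur to the first power, since
    s^2 > 4n, hence contribute at most the primorial of n, that is 4^n; primes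
    in (n, 4n] contribute at most 4n each.  Half of the exponential size 16^n
    thus has to come from the last range. *)
Lemma chebyshev_window n s : 0 < n -> 4 * n < s * s ->
  4 ^ n <= (4 * n) ^ (s + (\sum_(n.+1 <= p < (4 * n).+1 | prime p) 1).+1).
Proof.
move=> n0 hs.
have b := @central_binomial_ge (2 * n) _; rewrite mulnA in b.
pose C := 'C(4 * n, 2 * n).
have C0 : 0 < C by rewrite bin_gt0; lia.
have {}b : 4 ^ (2 * n) <= 4 * n * C by apply: b; lia.
have pf p : prime p -> p ^ logn p C <= 4 * n.
  move=> pp; rewrite /C (_ : 4 * n = 2 * (2 * n)); last lia.
  by apply: pfactor_central_binomial => //; lia.
pose N := \sum_(n.+1 <= p < (4 * n).+1 | prime p) 1.
suff Cle : C <= (4 * n) ^ s * 4 ^ n * (4 * n) ^ N.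
  rewrite addnS expnS expnD.
  have : 4 ^ n * 4 ^ n <= 4 ^ n * (4 * n * ((4 * n) ^ s * (4 * n) ^ N)).
    by rewrite -expnD addnn -mul2n; apply: leq_trans b _; rewrite -/N; nia.
  by rewrite leq_pmul2l // expn_gt0.
(* C + 4n bounds all prime factors of C and also 4n, where the product is cut *)
have {1}-> : C = \prod_(0 <= p < (C + 4 * n).+1 | prime p) p ^ logn p C.
  rewrite -{1}(partnT C0) (@widen_partn (C + 4 * n)) ?leq_addr //.
  rewrite [RHS]big_mkcond /=; apply: eq_bigr => p _.
  by case: ifP => // /negbT pp; rewrite lognE (negbTE pp).
rewrite (@big_cat_nat _ _ _ (4 * n).+1) //=; last lia.
rewrite [X in _ * X]big1_seq ?muln1 => [|p /andP[pp]]; last first.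
  rewrite mem_index_iota => /andP[p1 p2].
  have [->|] := posnP (logn p C); first by rewrite expn0.
  move=> l0; have := pf p pp.
  have : p ^ 1 <= p ^ logn p C by rewrite leq_exp2l ?prime_gt1.
  by rewrite expn1; lia.
rewrite (@big_cat_nat _ _ _ n.+1) //=; last lia.
apply: leq_mul; last first.
  rewrite /N; elim/big_rec2: _ => // p x y /pf pp xy.
  by rewrite expnD expn1 leq_mul.
apply: (@leq_trans (\prod_(0 <= p < n.+1 | prime p) ((4 * n) ^ (p < s) * p))).
  apply: leq_prod => p pp; case: ltnP => ps.
    by rewrite expn1 (leq_trans (pf _ pp)) // leq_pmulr ?prime_gt0.
  rewrite expn0 mul1n leqNgt; apply/negP; rewrite -{1}(expn1 p).
  rewrite (ltn_exp2l _ _ (prime_gt1 pp)) => l2.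
  have : p ^ 2 <= p ^ logn p C by rewrite (leq_exp2l _ _ (prime_gt1 pp)).
  have := pf _ pp; nia.
rewrite big_split /= leq_mul ?primorial_le // -expn_sum leq_pexp2l //;
  first lia.
rewrite -{2}(subn0 s); apply: leq_trans (@sum_indicator_ltn 0 n.+1 s).
by rewrite big_mkcond /=; apply: leq_sum => i _; case: ifP.
Qed.

(** Why 64: a prime q of (n, 4n] has the weight (n/q)^3 >= 1/64 in the filling
    condition, so 64 of them give the required total weight 1. *)
Lemma many_primes_window n : 4096 <= n ->
  64 <= \sum_(n.+1 <= p < (4 * n).+1 | prime p) 1.
Proof.
move=> hn; rewrite leqNgt; apply/negP => hN.
pose k := trunc_log 4 (4 * n).
have k1 : 4 ^ k <= 4 * n by apply: trunc_logP; lia.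
have k2 : 4 * n < 4 ^ k.+1 by apply: trunc_log_ltn.
have k7 : 7 <= k by apply: trunc_log_max => //;
  rewrite (_ : 4 ^ 7 = 4 * 4096) ?leq_mul2l.
have e4 : 4 ^ k.+1 = 2 ^ k.+1 * 2 ^ k.+1 by rewrite -expnMn.
have n0 : 0 < n by lia.
have := @chebyshev_window n (2 ^ k.+1) n0; rewrite -e4 => /(_ k2).
set N := bigop _ _ _ in hN *; move=> h.
have {h} : 4 ^ n < 4 ^ (k.+1 * (2 ^ k.+1 + 64)).
  apply: leq_ltn_trans h _; rewrite expnM.
  apply: (@leq_ltn_trans ((4 * n) ^ (2 ^ k.+1 + 64))).
    by rewrite leq_pexp2l; lia.
  by rewrite ltn_exp2r // addnC.
rewrite ltn_exp2l // => h.
have : k.+1 * (2 ^ k.+1 + 64) <= 4 ^ k.-1.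
  (* k = j + 7, and k >= 7 because 4n >= 4^7 *)
  have aux j : (j + 8) * (256 * 2 ^ j + 64) <= 4096 * 4 ^ j.
    by elim: j => // j IHj; rewrite !expnS; nia.
  have -> : k.+1 = (k - 7) + 8 by lia.
  have -> : k.-1 = 6 + (k - 7) by lia.
  rewrite !expnD (mulnC _ (2 ^ 8)); exact: aux.
have : 4 ^ k = 4 * 4 ^ k.-1 by rewrite -expnS prednK //; lia.
lia.
Qed.
End Primes.

(** * The terms d^-r and multiplicativity of the divisor sum *)

Definition term (R : realType) (r : R) (d : nat) : R := d%:R `^ (- r).

Lemma term1 (R : realType) (r : R) : term r 1 = 1.
Proof. by rewrite /term powR1. Qed.

Lemma termM (R : realType) (r : R) (m n : nat) :
  term r (m * n) = term r m * term r n.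
Proof. by rewrite /term natrM powRM. Qed.

Lemma termX (R : realType) (r : R) (p k : nat) :
  term r (p ^ k)%N = term r p ^+ k.
Proof.
by elim: k => [|k IHk]; [rewrite expn0 term1|rewrite expnS termM IHk exprS].
Qed.

Lemma term_gt0 (R : realType) (r : R) (d : nat) : (0 < d)%N -> 0 < term r d.
Proof. by move=> d0; rewrite powR_gt0 // ltr0n. Qed.

Lemma term_ratioE (R : realType) (r : R) (p q : nat) : (0 < p)%N ->
  term r q = (p%:R / q%:R) `^ r * term r p.
Proof.
move=> p0; rewrite powRM ?invr_ge0 // /term !powRN.
rewrite -[q%:R^-1]powR_inv1 // -powRrM mulN1r powRN mulrAC mulfV ?mul1r //.
by rewrite gt_eqF // powR_gt0 // ltr0n.
Qed.

Lemma ratio_powR_le (R : realType) (r s : R) (p q : nat) :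
  (0 < p <= q)%N -> r <= s -> (p%:R / q%:R : R) `^ s <= (p%:R / q%:R) `^ r.
Proof.
move=> /andP[p0 pq] rs; have q0 := leq_trans p0 pq; apply: ger_powR => //.
by rewrite divr_gt0 ?ltr0n //= ler_pdivrMr ?ltr0n // mul1r ler_nat.
Qed.

(** Comparing two terms through (p/q)^s makes inequalities between them
    monotone in the exponent: they need to be checked only at one extreme value
    s of r, where p/q can be raised to a rational power. *)
Lemma term_ratio_ge (R : realType) (r s : R) (p q : nat) :
  (0 < p <= q)%N -> r <= s -> (p%:R / q%:R) `^ s * term r p <= term r q.
Proof.
move=> pq rs; have /andP[p0 _] := pq; rewrite [leRHS](term_ratioE _ _ p0).
by rewrite ler_wpM2r ?ratio_powR_le // ltW ?term_gt0.
Qed.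

Lemma term_ratio_le (R : realType) (r s : R) (p q : nat) :
  (0 < p <= q)%N -> s <= r -> term r q <= (p%:R / q%:R) `^ s * term r p.
Proof.
move=> pq rs; have /andP[p0 _] := pq; rewrite [leLHS](term_ratioE _ _ p0).
by rewrite ler_wpM2r ?ratio_powR_le // ltW ?term_gt0.
Qed.

Lemma term_le (R : realType) (r : R) (m n : nat) :
  0 <= r -> (0 < m <= n)%N -> term r n <= term r m.
Proof.
by move=> r0 mn; have := term_ratio_le mn r0; rewrite powRr0 mul1r.
Qed.

Lemma term_le_inv (R : realType) (r : R) (d : nat) :
  1 <= r -> (0 < d)%N -> term r d <= d%:R^-1.
Proof.
move=> r1 d0; have := @term_ratio_le R r 1 1 d; rewrite d0 => /(_ isT r1).
by rewrite term1 mulr1 powRr1 ?divr_ge0 // mul1r.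
Qed.

Lemma term_lt1 (R : realType) (r : R) (d : nat) :
  1 <= r -> (1 < d)%N -> term r d < 1.
Proof.
move=> r1 d1; apply: le_lt_trans (term_le_inv r1 (ltnW d1)) _.
by rewrite invf_lt1 ?ltr0n ?ltr1n // ltnW.
Qed.

Definition geom_sum (R : realType) (x : R) (a : nat) : R :=
  \sum_(i < a.+1) x ^+ i.

Lemma geom_sum0 (R : realType) (x : R) : geom_sum x 0 = 1.
Proof. by rewrite /geom_sum big_ord1. Qed.

Lemma geom_sumS (R : realType) (x : R) a :
  geom_sum x a.+1 = geom_sum x a + x ^+ a.+1.
Proof. by rewrite /geom_sum big_ord_recr. Qed.

Lemma geom_sum1 (R : realType) (x : R) : geom_sum x 1 = 1 + x.
Proof. by rewrite geom_sumS geom_sum0 expr1. Qed.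

Lemma geom_sumE (R : realType) (x : R) a :
  geom_sum x a * (1 - x) = 1 - x ^+ a.+1.
Proof.
elim: a => [|a IHa]; first by rewrite geom_sum0 mul1r expr1.
by rewrite geom_sumS mulrDl IHa (exprS _ a.+1); ring.
Qed.

Lemma geom_sum_mono (R : realType) (x : R) a b :
  0 <= x -> (a <= b)%N -> geom_sum x a <= geom_sum x b.
Proof.
move=> x0 /subnKC <-; elim: (b - a)%N => [|k IHk]; first by rewrite addn0.
by rewrite addnS geom_sumS (le_trans IHk) // lerDl exprn_ge0.
Qed.

Lemma geom_sum_ge1 (R : realType) (x : R) a : 0 <= x -> 1 <= geom_sum x a.
Proof. by move=> x0; rewrite -(geom_sum0 x) geom_sum_mono. Qed.

Lemma geom_sum_lt (R : realType) (x : R) a :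
  0 < x < 1 -> geom_sum x a < (1 - x)^-1.
Proof.
move=> /andP[x0 x1]; rewrite -[ltRHS]mul1r ltr_pdivlMr ?subr_gt0 // geom_sumE.
by rewrite ltrBlDr ltrDl exprn_gt0.
Qed.

Lemma geom_sum_sup (R : realType) (x v : R) a0 : 0 < x < 1 -> v < (1 - x)^-1 ->
  exists2 a, (a0 <= a)%N & v < geom_sum x a.
Proof.
move=> /andP[x0 x1] vx; have x1' : 0 < 1 - x by rewrite subr_gt0.
have e0 : 0 < 1 - v * (1 - x) by rewrite subr_gt0 -ltr_pdivlMr // mul1r.
have /cvgr0_norm_lt /(_ _ e0) [N _ HN] : (GRing.exp x) @ \oo --> (0 : R).
  by apply: cvg_expr; rewrite ger0_norm // ltW.
exists (maxn a0 N); first exact: leq_maxl.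
have /= := HN (maxn a0 N).+1 (leqW (leq_maxr _ _)).
rewrite ger0_norm ?exprn_ge0 ?ltW // => h.
rewrite -(ltr_pM2r x1') geom_sumE; lra.
Qed.

Lemma sigma1 (R : realType) (r : R) : sigma_neg r 1 = 1.
Proof. by rewrite /sigma_neg big_seq1 -/(term r 1) term1. Qed.

(** A divisor of p^(a+1) m divides p^a m unless it is p^(a+1) times a divisor
    of m. *)
Lemma sigma_pfactorS (R : realType) (r : R) p a m :
  prime p -> (0 < m)%N -> ~~ (p %| m)%N ->
  sigma_neg r (p ^ a.+1 * m) =
  sigma_neg r (p ^ a * m) + term r p ^+ a.+1 * sigma_neg r m.
Proof.
move=> pp m0 pm; have p0 := prime_gt0 pp.
have pa0 b : (0 < p ^ b)%N by rewrite expn_gt0 p0.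
have pam b : (0 < p ^ b * m)%N by rewrite muln_gt0 pa0.
rewrite /sigma_neg mulr_sumr.
under [X in _ = _ + X]eq_bigr => d _.
  by rewrite -/(term r d) -termX -termM; over.
rewrite -(big_map (fun d => p ^ a.+1 * d)%N predT (fun d => term r d)) -big_cat.
apply: perm_big; apply: uniq_perm; first exact: divisors_uniq.
  rewrite cat_uniq divisors_uniq map_inj_uniq ?divisors_uniq ?andbT; last first.
    by move=> x y /eqP; rewrite eqn_pmul2l // => /eqP.
  apply/hasPn => x /mapP[d]; rewrite -!dvdn_divisors // => dm ->.
  apply/negP; rewrite expnSr -mulnA dvdn_pmul2l // => h.
  by case/negP: pm; apply: dvdn_trans h; apply: dvdn_mulr.
move=> x; rewrite mem_cat -!dvdn_divisors //; apply/idP/orP.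
  move=> xd; have [pax|pax] := boolP (p ^ a.+1 %| x)%N.
    right; case/dvdnP: pax xd => d ->; rewrite mulnC dvdn_pmul2l // => dm.
    by apply/mapP; exists d; rewrite -?dvdn_divisors.
  left.
  have x0 : (0 < x)%N by apply: dvdn_gt0 xd.
  have [y py ey] := pfactor_coprime pp x0.
  have ly : (logn p x <= a)%N.
    by rewrite leqNgt -(pfactor_dvdn _ pp x0).
  rewrite ey mulnC; apply: dvdn_mul; first exact: dvdn_exp2l.
  have : (y %| p ^ a.+1 * m)%N by apply: dvdn_trans xd; rewrite ey dvdn_mulr.
  by rewrite Gauss_dvdr // coprime_sym coprimeXl.
case=> [|/mapP[d]]; first by move/dvdn_trans; apply;
  rewrite expnS -mulnA dvdn_mull.
by rewrite -dvdn_divisors // => dm ->; rewrite dvdn_pmul2l.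
Qed.

Lemma sigma_pfactor (R : realType) (r : R) p a m :
  prime p -> (0 < m)%N -> ~~ (p %| m)%N ->
  sigma_neg r (p ^ a * m) = geom_sum (term r p) a * sigma_neg r m.
Proof.
move=> pp m0 pm; elim: a => [|a IHa]; first by rewrite expn0 mul1n geom_sum0
  mul1r.
by rewrite sigma_pfactorS // IHa geom_sumS mulrDl.
Qed.

Lemma sigma_ge1 (R : realType) (r : R) n : (0 < n)%N -> 1 <= sigma_neg r n.
Proof.
move=> n0; rewrite /sigma_neg (perm_big _ (perm_to_rem (divisor1 n))) big_cons.
by rewrite -/(term r 1) term1 lerDl sumr_ge0 // => d _; exact: powR_ge0.
Qed.

Lemma sigma_ge0 (R : realType) (r : R) n : 0 <= sigma_neg r n.
Proof. by apply: sumr_ge0 => d _; exact: powR_ge0. Qed.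

(** * Greedy approximation from below *)

(** Approximation is one-sided and multiplicative so that the quotient of the
    target by the value already reached is again a target to be approximated
    from below, with the same relative error e. *)
Definition approx_below (R : realType) (r e : R) (B : set nat) (v : R) : Prop :=
  exists2 m, B m & sigma_neg r m <= v <= (1 + e) * sigma_neg r m.

Lemma approx_belowS (R : realType) (r e : R) (A B : set nat) (v : R) :
  A `<=` B -> approx_below r e A v -> approx_below r e B v.
Proof. by move=> AB [m Am h]; exists m => //; exact: AB. Qed.

Definition with_power (p a0 : nat) (B : set nat) : set nat :=
  [set n | exists a m, [/\ (a0 <= a)%N, B m & n = (p ^ a * m)%N]].

(** One step of the greedy construction.  Write x = p^-r.  Take the largest
    exponent a >= a0 with b * geom_sum x a <= v, and approximate the quotient
    of v by geom_sum x a with elements of B.  If the exponent a+1 overshoots,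
    this quotient is below b times the ratio of two consecutive geometric sums,
    which is at most 1 + x^(a0+1); this is the case of the last hypothesis.
    If no exponent overshoots, a large enough a brings the quotient below F,
    because the geometric sums tend to 1/(1 - x). *)
Lemma greedy_step (R : realType) (r e b F : R) (p a0 : nat) (B : set nat) :
  1 <= r -> prime p -> (forall m, B m -> (0 < m)%N /\ ~~ (p %| m)%N) -> 0 < b ->
  (forall v, b <= v -> v < F -> approx_below r e B v) ->
  (forall v, b <= v -> v < b * (1 + term r p ^+ a0.+1) ->
    approx_below r e B v) ->
  forall v, b * geom_sum (term r p) a0 <= v -> v < F / (1 - term r p) ->
  approx_below r e (with_power p a0 B) v.
Proof.
move=> r1 pp HB b0 HF HJ v bv vF.
set x := term r p in HJ bv vF *.
have x0 : 0 < x by apply/term_gt0/prime_gt0.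
have x1 : x < 1 by apply/term_lt1/prime_gt1.
have x1' : 0 < 1 - x by rewrite subr_gt0.
have g0 a : 0 < geom_sum x a by rewrite (lt_le_trans _ (geom_sum_ge1 a (ltW
  x0))).
have v0 : 0 < v by apply: lt_le_trans bv; exact: mulr_gt0.
have F0 : 0 < F.
  by have := lt_trans v0 vF; rewrite pmulr_lgt0 // invr_gt0.
have lift a : (a0 <= a)%N -> approx_below r e B (v / geom_sum x a) ->
    approx_below r e (with_power p a0 B) v.
  move=> a0a [m Bm /andP[m1 m2]]; have [m0 pm] := HB _ Bm.
  exists (p ^ a * m)%N; first by exists a, m.
  rewrite sigma_pfactor // -/x; move: m1 m2.
  rewrite ler_pdivlMr // ler_pdivrMr // => m1 m2.
  by rewrite [geom_sum _ _ * _]mulrC m1 mulrA.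
have [[a a0a va]|] := pselect (exists2 a, (a0 <= a)%N & v < b * geom_sum x a).
  have [k] : exists2 k, b * geom_sum x (a0 + k) <= v &
      v < b * geom_sum x (a0 + k).+1.
    have : ~~ (v < b * geom_sum x a0) by rewrite -leNgt.
    move: va; rewrite -(subnKC a0a); elim: (a - a0)%N => [|k IHk].
      by rewrite addn0 => ->.
    rewrite addnS; case: (ltP v (b * geom_sum x (a0 + k))) => [/IHk//|h1 h2 _].
    by exists k.
  move=> k1 k2; apply: (lift (a0 + k)%N); rewrite ?leq_addr //.
  apply: HJ; first by rewrite ler_pdivlMr.
  rewrite ltr_pdivrMr //; apply: lt_le_trans k2 _.
  rewrite -mulrA ler_pM2l // geom_sumS mulrDl mul1r lerD2l.
  have xx : x ^+ (a0 + k).+1 <= x ^+ a0.+1.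
    by rewrite ler_wiXn2l ?ltW // ltnS leq_addr.
  apply: le_trans xx _; rewrite ler_peMr ?exprn_ge0 ?(ltW x0) //.
  exact: (geom_sum_ge1 _ (ltW x0)).
move=> no; have le a : (a0 <= a)%N -> b * geom_sum x a <= v.
  by move=> a0a; rewrite leNgt; apply/negP => h; apply: no; exists a.
have [a a0a ha] : exists2 a, (a0 <= a)%N & v / F < geom_sum x a.
  by apply: geom_sum_sup; rewrite ?x0 // ltr_pdivrMr // mulrC.
apply: (lift a) => //; apply: HF; first by rewrite ler_pdivlMr // le.
by rewrite ltr_pdivrMr // mulrC -ltr_pdivrMr.
Qed.

Lemma approx_below_closure (R : realType) (r : R) (B : set nat) (v : R) :
  (forall e, 0 < e -> approx_below r e B v) ->
  closure [set sigma_neg r n | n in B] v.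
Proof.
move=> H; have v0 : 0 <= v.
  by have [m _ /andP[mv _]] := H 1 ltr01; exact: le_trans (sigma_ge0 _ _) mv.
have v1 : 0 < v + 1 by rewrite ltr_wpDl.
move=> U /nbhs_ballP[d d0 dU].
have [m Bm /andP[m1 m2]] := H (d / (v + 1)) (divr_gt0 d0 v1).
exists (sigma_neg r m); split; first by exists m.
apply: dU; rewrite /ball /= ger0_norm ?subr_ge0 //.
apply: (@le_lt_trans _ _ (d / (v + 1) * v)).
  rewrite lerBlDl; apply: le_trans m2 _; rewrite mulrDl mul1r lerD2l.
  by rewrite ler_wpM2l // divr_ge0 // ltW.
by rewrite mulrAC ltr_pdivrMr // ltr_pM2l // ltrDl.
Qed.

(** Such a set has the same closure as its convex hull, an interval. *)
Lemma connected_closure_hull (R : realType) (A : set R) :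
  (forall a b v, A a -> A b -> a <= v -> v <= b -> closure A v) ->
  connected (closure A).
Proof.
move=> H; pose J := [set v | exists a b, [/\ A a, A b, a <= v & v <= b]].
have -> : closure A = closure J.
  apply/seteqP; split.
    by apply: closure_subset => v Av; exists v, v.
  have /closure_id -> := @closed_closure _ A.
  by apply: closure_subset => v [a [b [Aa Ab av vb]]]; exact: H Aa Ab av vb.
apply: connected_closure; apply/connected_intervalP.
move=> x y [a [b [Aa Ab ax xb]]] [c [d [Ac Ad cy yd]]] z /andP[xz zy].
by exists a, d; split => //; [exact: le_trans ax xz|exact: le_trans zy yd].
Qed.

(** * Counting components *)

(** All points of a piece A i have the same component, so i determines it. *)
Lemma components_le (T : topologicalType) (X : set T) (n : nat)
    (A : nat -> set T) :
  X = \bigcup_(i in `I_n) A i -> (forall i, (i < n)%N -> connected (A i)) ->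
  (components X #<= `I_n)%card.
Proof.
move=> XA cA.
pose f i := \bigcup_(x in A i) connected_component X x.
apply: card_le_trans (card_image_le f _); apply: subset_card_le.
move=> _ [x Xx <-]; have [i /= ni Aix] : (\bigcup_(i in `I_n) A i) x.
  by rewrite -XA.
exists i => //.
have AX : A i `<=` X by move=> z Az; rewrite XA; exists i.
apply/seteqP; split => [y [z Aiz zy]|y xy]; last by exists x.
suff -> : connected_component X x = connected_component X z by [].
apply: same_connected_component.
exact: connected_component_max AX (cA _ ni) _ Aiz.
Qed.

(** A component is an interval, so it cannot contain two of the points p i
    without containing a missing point g i between them. *)
Lemma components_ge (R : realType) (X : set R) (n : nat) (p g : nat -> R) :
  (forall i, (i <= n)%N -> X (p i)) ->
  (forall i, (i < n)%N -> [/\ ~ X (g i), p i < g i & g i < p i.+1]) ->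
  (`I_n.+1 #<= components X)%card.
Proof.
move=> Xp Xg; pose f i := connected_component X (p i).
have mono i j : (i <= j)%N -> (j <= n)%N -> p i <= p j.
  move=> /subnKC <-; elim: (j - i)%N => [|k IHk]; first by rewrite addn0.
  rewrite addnS => kn; apply: le_trans (IHk (ltnW kn)) _.
  by have [_ h1 h2] := Xg _ kn; rewrite ltW // (lt_trans h1).
have finj i j : (i < j)%N -> (j <= n)%N -> f i <> f j.
  move=> ij jn fij; have [gX pg gp] := Xg i (leq_trans ij jn).
  have gj : g i <= p j by rewrite (le_trans (ltW gp)) // mono.
  have hi : f i (p i) by apply: connected_component_refl; apply/Xp; lia.
  have hj : f i (p j) by rewrite fij; apply: connected_component_refl;
    exact: Xp.
  apply: gX; apply: (@connected_component_sub _ X (p i)).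
  have /connected_intervalP := @component_connected _ X (p i).
  by apply; [exact: hi|exact: hj|rewrite (ltW pg)].
apply: (@card_le_trans _ _ _ (f @` `I_n.+1)).
  suff : (f @` `I_n.+1 #= `I_n.+1)%card by rewrite card_eq_le => /andP[].
  apply: inj_card_eq => i j; rewrite !inE /= => ni nj fij.
  have [ij|ji|//] := ltngtP i j; first by case: (finj _ _ ij nj).
  by case: (finj _ _ ji ni).
by apply: subset_card_le => _ [i /= ni <-]; exists (p i) => //; apply: Xp.
Qed.

(** * Rough numbers and tails of the Euler product *)

Definition rough (k : nat) : set nat :=
  [set n | (0 < n)%N /\ forall p, prime p -> (p %| n)%N -> (k <= p)%N].

(** The product of the limits 1/(1 - q^-r) of the divisor sums of powers of q;
    letting M grow gives the supremum of the divisor sum over k-rough integers,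
    which is infinite for r = 1.  Working with finite M treats r = 1 and r > 1
    alike. *)
Definition euler_prod (R : realType) (r : R) (k M : nat) : R :=
  \prod_(k <= q < M | prime q) (1 - term r q)^-1.

Lemma rough1 k : rough k 1.
Proof. by split=> // p pp; rewrite dvdn1 => /eqP p1; rewrite p1 in pp. Qed.

Lemma roughS k : rough k.+1 `<=` rough k.
Proof. by move=> n [n0 H]; split=> // p pp pn; exact: ltnW (H p pp pn). Qed.

Lemma rough_composite k : ~~ prime k -> rough k = rough k.+1.
Proof.
move=> kp; apply/seteqP; split; last exact: roughS.
move=> n [n0 H]; split=> // p pp pn; rewrite ltn_neqAle H // andbT.
by apply: contraNneq kp => ->.
Qed.

Lemma rough_coprime p m : prime p -> rough p.+1 m -> (0 < m)%N /\ ~~ (p %| m)%N.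
Proof.
by move=> pp [m0 H]; split=> //; apply/negP => /(H p pp); rewrite ltnn.
Qed.

Lemma rough_prime k : prime k -> rough k = with_power k 0 (rough k.+1).
Proof.
move=> kp; apply/seteqP; split.
  move=> n [n0 H]; have [m km nm] := pfactor_coprime kp n0.
  exists (logn k n), m; split=> //; last by rewrite mulnC.
  split=> [|p pp pm]; first by rewrite nm muln_gt0 in n0; case/andP: n0.
  rewrite ltn_neqAle H ?andbT //; last by rewrite nm dvdn_mulr.
  apply: contraTneq km => ->; by rewrite prime_coprime // pm.
move=> _ [a [m [_ [m0 H] ->]]]; split.
  by rewrite muln_gt0 m0 expn_gt0 prime_gt0.
move=> p pp; rewrite Euclid_dvdM // => /orP[|/(H _ pp)/ltnW//].
by rewrite Euclid_dvdX // => /andP[]; rewrite dvdn_prime2 // => /eqP ->.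
Qed.

Lemma euler_prod_nil (R : realType) (r : R) k M :
  (M <= k)%N -> euler_prod r k M = 1.
Proof. by move=> Mk; rewrite /euler_prod big_geq. Qed.

Lemma euler_prod_prime (R : realType) (r : R) k M : prime k -> (k < M)%N ->
  euler_prod r k M = euler_prod r k.+1 M / (1 - term r k).
Proof. by move=> kp kM; rewrite /euler_prod big_ltn_cond // kp mulrC. Qed.

Lemma euler_prod_composite (R : realType) (r : R) k M : ~~ prime k ->
  euler_prod r k M = euler_prod r k.+1 M.
Proof.
move=> kp; have [kM|Mk] := ltnP k M; last by rewrite !euler_prod_nil // ltnW.
by rewrite /euler_prod big_ltn_cond // (negbTE kp).
Qed.

Lemma euler_prod_ge1 (R : realType) (r : R) k M :
  1 <= r -> 1 <= euler_prod r k M.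
Proof.
move=> r1; rewrite /euler_prod; elim/big_rec: _ => // q x qp x1.
have q1 := term_lt1 r1 (prime_gt1 qp); have q0 := term_gt0 r (prime_gt0 qp).
rewrite mulrC ler_pdivlMr ?subr_gt0 // mul1r; lra.
Qed.

Lemma euler_prod_ge_sum (R : realType) (r : R) k M : 1 <= r ->
  1 + \sum_(k <= q < M | prime q) term r q <= euler_prod r k M.
Proof.
move=> r1; rewrite /euler_prod.
suff : 1 + \sum_(k <= q < M | prime q) term r q <=
   \prod_(k <= q < M | prime q) (1 - term r q)^-1 /\
   0 <= \sum_(k <= q < M | prime q) term r q by case.
elim/big_rec2: _ => [|q x y qp [xy y0]]; first by rewrite addr0.
have q1 := term_lt1 r1 (prime_gt1 qp); have q0 := term_gt0 r (prime_gt0 qp).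
split; last by lra.
rewrite mulrC ler_pdivlMr ?subr_gt0 //; nra.
Qed.

Lemma sigma_le_euler_prod (R : realType) (r : R) k M n : 1 <= r -> rough k n ->
  (forall p, prime p -> (p %| n)%N -> (p < M)%N) ->
  sigma_neg r n <= euler_prod r k M.
Proof.
move=> r1; have [j] := ubnP (M - k)%N; elim: j k n => // j IHj k n jk kn nM.
have [Mk|kM] := leqP M k.
  rewrite euler_prod_nil //; have [n0 H] := kn.
  suff -> : n = 1%N by rewrite sigma1.
  apply/eqP; rewrite eqn_leq n0 andbT leqNgt; apply/negP => n1.
  have := H _ (pdiv_prime n1) (pdiv_dvd n).
  by have := nM _ (pdiv_prime n1) (pdiv_dvd n); lia.
have jk' : (M - k.+1 < j)%N by lia.
have [kp|kp] := boolP (prime k); last first.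
  rewrite euler_prod_composite //; apply: IHj => //.
  by rewrite -rough_composite.
have k1 := term_lt1 r1 (prime_gt1 kp); have k0 := term_gt0 r (prime_gt0 kp).
rewrite euler_prod_prime //.
move: kn nM; rewrite rough_prime // => -[a [m [_ km ->]]] nM.
have [m0 nkm] := rough_coprime kp km.
rewrite sigma_pfactor // mulrC ler_pM ?sigma_ge0 //.
- by rewrite (le_trans ler01) // geom_sum_ge1 // ltW.
- by apply: IHj => // p pp pm; apply: nM => //; exact: dvdn_mull.
- by apply/ltW/geom_sum_lt; rewrite k0.
Qed.

(** The primes above p are able to fill the gap between 1 and 1 + p^-r, the
    widest relative gap left by the powers of p.  This is the condition
    1 + p^-r <= prod_(q > p) 1/(1 - q^-r), stated without infinite products. *)
Definition tail_fills (R : realType) (r : R) (p : nat) : Prop :=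
  forall v, v < 1 + term r p -> exists M, v < euler_prod r p.+1 M.

Lemma tail_fills_sum (R : realType) (r : R) p M : 1 <= r ->
  term r p <= \sum_(p.+1 <= q < M | prime q) term r q -> tail_fills r p.
Proof.
move=> r1 h v vp; exists M; apply: lt_le_trans (euler_prod_ge_sum _ _ r1).
by apply: lt_le_trans vp _; rewrite lerD2l.
Qed.

Lemma greedy_rough_step (R : realType) (r e : R) k M v : 1 <= r -> prime k ->
  (forall w, 1 <= w -> w < euler_prod r k.+1 M ->
    approx_below r e (rough k.+1) w) ->
  (forall w, 1 <= w -> w < 1 + term r k -> approx_below r e (rough k.+1) w) ->
  1 <= v -> v < euler_prod r k M -> approx_below r e (rough k) v.
Proof.
move=> r1 kp H1 H2 v1 vM.
have kM : (k < M)%N.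
  by rewrite ltnNge; apply/negP => Mk; move: vM; rewrite euler_prod_nil //; lra.
rewrite rough_prime //; rewrite euler_prod_prime // in vM.
apply: (@greedy_step _ _ _ 1 _ _ _ _ r1 kp) (vM) => // [m| w w1|];
  first exact: rough_coprime.
  by rewrite mul1r expr1; exact: H2.
by rewrite geom_sum0 mulr1.
Qed.

(** When every prime from k on satisfies the filling condition, the divisor
    sums of k-rough integers leave no gap.  Once k is so large that k^-r <= e,
    the integer 1 already approximates any value below 1 + k^-r, and an
    induction on the number of factors of the Euler product suffices; below
    that threshold, the filling condition supplies a new Euler product when the
    greedy step stops, and the induction goes down on k. *)
Lemma rough_approx_below (R : realType) (r : R) k M v e : 1 <= r -> 0 < e ->
  (forall p, prime p -> (k <= p)%N -> tail_fills r p) ->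
  1 <= v -> v < euler_prod r k M -> approx_below r e (rough k) v.
Proof.
move=> r1 e0.
have [K HK] : exists K, forall p, (K < p)%N -> term r p <= e.
  exists (Num.truncn e^-1) => p Kp.
  have p0 : (0 < p)%N by apply: leq_trans Kp.
  apply: le_trans (term_le_inv r1 p0) _.
  rewrite -[leRHS]invrK lef_pV2 ?posrE ?invr_gt0 ?ltr0n //.
  apply: (@le_trans _ _ (Num.truncn e^-1).+1%:R); last by rewrite ler_nat.
  by rewrite ltW // truncnS_gt.
have large j : forall k M v, (M - k <= j)%N -> (K < k)%N ->
    1 <= v -> v < euler_prod r k M ->
    approx_below r e (rough k) v.
  elim: j => [|j IHj] {}k {}M {}v jM Kk v1 vM.
    by move: vM; rewrite euler_prod_nil; [lra|lia].
  have [kp|kp] := boolP (prime k); last first.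
    rewrite rough_composite //; rewrite euler_prod_composite // in vM.
    by apply: (IHj _ M) => //; lia.
  apply: (@greedy_rough_step _ _ _ _ M) => // [w w1 wM|w w1 wk].
    by apply: (IHj _ M) => //; lia.
  exists 1%N; first exact: rough1.
  rewrite sigma1 w1 mulr1 (le_trans (ltW wk)) // lerD2l; exact: HK.
have [j] := ubnP (K.+1 - k)%N; elim: j k M v => // j IHj k M v jk fills v1 vM.
have [Kk|kK] := ltnP K k; first exact: (large (M - k)%N) vM.
have fills' p : prime p -> (k.+1 <= p)%N -> tail_fills r p.
  by move=> pp kp; apply: fills => //; exact: ltnW.
have jk' : (K.+1 - k.+1 < j)%N by lia.
have [kp|kp] := boolP (prime k); last first.
  rewrite rough_composite //; rewrite euler_prod_composite // in vM.
  exact: IHj vM.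
apply: (@greedy_rough_step _ _ _ _ M) => // [w w1 wM|w w1 wk].
  exact: IHj wM.
have [M' wM] := fills _ kp (leqnn k) _ wk.
exact: IHj wM.
Qed.

(** * At most three components when 5 is filled *)

Lemma euler_prod_mono (R : realType) (r : R) k M M' : 1 <= r -> (M <= M')%N ->
  euler_prod r k M <= euler_prod r k M'.
Proof.
move=> r1 MM'; have [kM|Mk] := leqP k M; last first.
  by rewrite (euler_prod_nil _ (ltnW Mk)) euler_prod_ge1.
rewrite [leRHS]/euler_prod (@big_cat_nat _ _ _ M) //= -/(euler_prod r k M)
  -/(euler_prod r M M').
rewrite ler_peMr //.
  by rewrite (le_trans ler01) // euler_prod_ge1.
exact: euler_prod_ge1.
Qed.

Lemma sigma_le_some_euler_prod (R : realType) (r : R) k n M0 :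
  1 <= r -> rough k n ->
  exists2 M, (M0 <= M)%N & sigma_neg r n <= euler_prod r k M.
Proof.
move=> r1 kn; exists (n.+1 + M0)%N; first exact: leq_addl.
apply: sigma_le_euler_prod => // p _ /dvdn_leq; rewrite kn.1 => /(_ isT); lia.
Qed.

Lemma with_power_rough p a0 : prime p ->
  with_power p a0 (rough p.+1) `<=` rough p.
Proof.
by move=> pp _ [a [m [_ pm ->]]]; rewrite rough_prime //; exists a, m.
Qed.

Lemma sigma_with_power_ge (R : realType) (r : R) p a0 n : prime p ->
  with_power p a0 (rough p.+1) n -> geom_sum (term r p) a0 <= sigma_neg r n.
Proof.
move=> pp [a [m [a0a pm ->]]]; have [m0 npm] := rough_coprime pp pm.
have p0 := term_gt0 r (prime_gt0 pp).
rewrite sigma_pfactor // (le_trans (geom_sum_mono (ltW p0) a0a)) // ler_peMr //.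
  by rewrite (le_trans ler01) // geom_sum_ge1 // ltW.
exact: sigma_ge1.
Qed.

Lemma connected_closure_sigma (R : realType) (r : R) (B : set nat) :
  (forall n m v e, B n -> B m -> sigma_neg r n <= v -> v < sigma_neg r m ->
     0 < e -> approx_below r e B v) ->
  connected (closure [set sigma_neg r n | n in B]).
Proof.
move=> H; apply: connected_closure_hull => _ _ v [n Bn <-] [m Bm <-] nv.
rewrite le_eqVlt => /orP[/eqP ->|vm]; first by apply: subset_closure; exists m.
by apply: approx_below_closure => e; exact: H Bn Bm nv vm.
Qed.

(** The three connected pieces are the closures of the divisor sums of the
    5-rough integers, of the odd multiples of 3, and of the even integers.  Put
    x = 2^-r, y = 3^-r, c = 5^-r.  By the filling condition at 5, the
    5-rough values fill [1, T) with T >= (1 + c)/(1 - c), so a power of 2 or 3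
    with positive exponent creates no gap: consecutive sums then differ by a
    factor at most 1 + x^2 or 1 + y^2, both at most T.  In the even case there
    are two filled ranges, from the multiples of 2 prime to 3 and from the
    multiples of 6; they overlap because (1 + x)(1 + y) <= T/(1 - x), which is
    where y <= x^2 + 2c is used. *)
Lemma components_le3 (R : realType) (r : R) : 1 <= r ->
  (forall p, prime p -> (5 <= p)%N -> tail_fills r p) ->
  term r 2 ^+ 2 <= 2 * term r 5 -> term r 3 <= term r 2 ^+ 2 + 2 * term r 5 ->
  (components (closure (sigma_neg_range r)) #<= `I_3)%card.
Proof.
move=> r1 fills; set x := term r 2; set y := term r 3; set c := term r 5.
move=> xc yxc.
have x0 : 0 < x by apply: term_gt0.
have y0 : 0 < y by apply: term_gt0.
have c0 : 0 < c by apply: term_gt0.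
have x1 : x < 1 by apply: term_lt1.
have y1 : y < 1 by apply: term_lt1.
have c1 : c < 1 by apply: term_lt1.
(* the filling condition at 5, with the geometric factor 1/(1 - c) of 5 added *)
have fill5 w : w * (1 - c) < 1 + c ->
    exists2 M, (5 < M)%N & w < euler_prod r 5 M.
  move=> wc; have [M hM] := fills 5 isT (leqnn 5) _ wc.
  exists (maxn M 6); first exact: leq_maxr.
  rewrite euler_prod_prime ?leq_maxr //.
  by rewrite ltr_pdivlMr ?subr_gt0 // (lt_le_trans hM) // euler_prod_mono
    ?leq_maxl.
have approx5 e M v : 0 < e -> 1 <= v -> v < euler_prod r 5 M ->
    approx_below r e (rough 5) v.
  by move=> e0 v1 vM; exact: rough_approx_below vM.
have rough4 : rough 4 = rough 5 by rewrite rough_composite.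
have eprod3 M : (5 < M)%N -> euler_prod r 3 M = euler_prod r 5 M / (1 - y).
  by move=> M5; rewrite euler_prod_prime //; [rewrite euler_prod_composite|lia].
have eprod2 M : (5 < M)%N ->
    euler_prod r 2 M = euler_prod r 5 M / (1 - y) / (1 - x).
  by move=> M5; rewrite euler_prod_prime //; [rewrite eprod3|lia].
have cop3 m : rough 5 m -> (0 < m)%N /\ ~~ (3 %| m)%N.
  by rewrite -rough4; exact: rough_coprime.
have cop2 m : rough 3 m -> (0 < m)%N /\ ~~ (2 %| m)%N by exact: rough_coprime.
have rough53 : rough 5 `<=` rough 3 by rewrite -rough4; exact: roughS.
pose B2 := with_power 3 1 (rough 5).
have B23 : B2 `<=` rough 3 by rewrite /B2 -rough4; exact: with_power_rough.
have approx3 e M v : 0 < e -> 1 + y <= v -> v < euler_prod r 5 M / (1 - y) ->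
    approx_below r e B2 v.
  move=> e0 v1 vM.
  apply: (@greedy_step _ _ _ 1 _ _ _ _ r1 _ cop3) vM => // [w w1 wM|w w1 wy|].
  - exact: approx5 wM.
  - have [M' _ hM'] : exists2 M, (5 < M)%N & w < euler_prod r 5 M.
      apply: fill5; rewrite mul1r -/y in wy.
      have y2c : y ^+ 2 <= c.
        by rewrite /y /c -termX; apply: term_le; rewrite ?(le_trans ler01).
      nra.
    exact: approx5 hM'.
  - by rewrite mul1r geom_sum1.
pose B (i : nat) := if i is 0%N then rough 5 else if i is 1%N then B2
  else with_power 2 1 (rough 3).
apply: (@components_le _ _ _ (fun i => closure [set sigma_neg r n | n in B i])).
  have -> : sigma_neg_range r = [set sigma_neg r n | n in B 0%N] `|`
      [set sigma_neg r n | n in B 1%N] `|` [set sigma_neg r n | n in B 2%N].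
    rewrite -!image_setU; congr image; apply/seteqP; split=> n; last first.
      by case=> [[[]|/B23[]]|/(@with_power_rough 2 1 isT)[]].
    move=> n0; have : rough 2 n by split=> // p /prime_gt1.
    rewrite rough_prime // => -[[|a] [m [_ km ->]]]; last by right;
      exists a.+1, m.
    rewrite expn0 mul1n; left; move: km; rewrite rough_prime // rough4.
    move=> [[|b] [w [_ kw ->]]]; last by right; exists b.+1, w.
    by left; rewrite expn0 mul1n.
  rewrite !closureU; apply/seteqP; split=> v.
    by case=> [[h|h]|h]; [exists 0%N|exists 1%N|exists 2%N].
  by move=> [[|[|[|//]]] _ h]; [left; left|left; right|right].
move=> [_|[_|[_|//]]] /=; apply: connected_closure_sigma => n m v e.
- move=> Bn Bm nv vm e0; have [M _ mM] := sigma_le_some_euler_prod 0 r1 Bm.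
  apply: approx5 (lt_le_trans vm mM) => //.
  by rewrite (le_trans _ nv) // sigma_ge1 // Bn.1.
- move=> Bn Bm nv vm e0; have [M M6 mM] := sigma_le_some_euler_prod 6 r1 (B23 _
  Bm).
  apply: (approx3 _ M) => //; last by rewrite -eprod3 // (lt_le_trans vm).
  rewrite (le_trans _ nv) // -geom_sum1; apply: sigma_with_power_ge => //.
  by rewrite rough4.
- move=> Bn Bm nv vm e0.
  have [M M6 mM] := sigma_le_some_euler_prod 6 r1 (@with_power_rough 2 1 isT _
    Bm).
  have {vm mM}vM : v < euler_prod r 2 M by exact: lt_le_trans mM.
  have xv : 1 + x <= v by rewrite (le_trans _ nv) // -geom_sum1;
    exact: sigma_with_power_ge.
  have c5 w : w < 1 + x ^+ 2 -> w * (1 - c) < 1 + c by move=> ?; nra.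
  (* below (1 + y)(1 + x) use multiples of 2 prime to 3, above it those of 6 *)
  have [v_lt|v_ge] := ltP v ((1 + y) * (1 + x)).
    have [M' _ hM'] : exists2 M, (5 < M)%N & v * (1 - x) < euler_prod r 5 M.
      apply: fill5.
      have h1 : v * (1 - x) < (1 + y) * (1 - x ^+ 2) by nra.
      have h2 : (1 + y) * (1 - x ^+ 2) <= 1 + y - x ^+ 2 by nra.
      have h3 : v * (1 - x) < 1 + 2 * c by lra.
      nra.
    apply: (@approx_belowS _ _ _ (with_power 2 1 (rough 5))).
      by move=> _ [a [w [a1 /rough53 kw ->]]]; exists a, w.
    apply: (@greedy_step _ _ _ 1 (euler_prod r 5 M') _ _ _ r1 _ (fun m h =>
      cop2 m (rough53 m h))) => //.
    + by move=> w w1 wM; exact: approx5 wM.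
    + move=> w w1; rewrite mul1r => /c5/fill5[M'' _ hw]; exact: approx5 hw.
    + by rewrite mul1r geom_sum1.
    + by rewrite ltr_pdivlMr // subr_gt0.
  apply: (@approx_belowS _ _ _ (with_power 2 1 B2)).
    by move=> _ [a [w [a1 /B23 kw ->]]]; exists a, w.
  apply: (@greedy_step _ _ _ (1 + y) (euler_prod r 5 M / (1 - y)) _ _ _ r1 _
    (fun m h => cop2 m (B23 m h))) => //.
  + by rewrite addr_gt0.
  + by move=> w; exact: approx3.
  + move=> w w1 wx.
    have [M' _ hM'] : exists2 M, (5 < M)%N & w * (1 - y) < euler_prod r 5 M.
      apply: fill5; apply: c5.
      have : w * (1 - y) < (1 - y ^+ 2) * (1 + x ^+ 2) by rewrite -/x in wx;
        nra.
      nra.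
    apply: (approx3 _ M') => //; by rewrite ltr_pdivlMr // subr_gt0.
  + by rewrite geom_sum1.
  + by rewrite -eprod2.
Qed.

(** * At least five components when 5 is not filled *)

Lemma gap_not_closure (R : realType) (S : set R) (l h g : R) :
  (forall s, S s -> s <= l \/ h <= s) -> l < g -> g < h -> ~ closure S g.
Proof.
move=> Slh lg gh Sg.
have cl : closed ([set x : R | x <= l] `|` [set x : R | h <= x]).
  by apply: closedU; [exact: closed_le|exact: closed_ge].
have : closure S `<=` [set x : R | x <= l] `|` [set x : R | h <= x].
  have /closure_id -> := cl; apply: closure_subset => s /Slh[]; by [left|right].
by move=> /(_ _ Sg)[] /=; lra.
Qed.

Lemma components_ge_gaps (R : realType) (S : set R) (n : nat) (p l : nat -> R) :
  (forall i, (i <= n)%N -> S (p i)) ->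
  (forall i, (i < n)%N -> [/\ p i <= l i, l i < p i.+1 &
     forall s, S s -> s <= l i \/ p i.+1 <= s]) ->
  (`I_n.+1 #<= components (closure S))%card.
Proof.
move=> Sp Sl; apply: (@components_ge _ _ _ p (fun i => (l i + p i.+1) / 2)).
  by move=> i ni; apply: subset_closure; exact: Sp.
move=> i ni; have [pl lp Slp] := Sl i ni; split; [|lra..].
by apply: gap_not_closure Slp _ _; lra.
Qed.

Lemma term_ratio_sqr (R : realType) (r : R) (p q : nat) :
  (0 < p <= q)%N -> 2 <= r -> term r q <= (p%:R / q%:R) ^+ 2 * term r p.
Proof.
by move=> pq r2; rewrite -powR_mulrn ?divr_ge0 //; exact: term_ratio_le.
Qed.

(** The hypothesis says that the filling condition fails at 5.  There are then
    four gaps, ending at 1 + 5^-r, 1 + 3^-r, 1 + 2^-r and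
    (1 + 2^-r)(1 + 5^-r).  The gap below 1 + 5^-r reappears multiplied by
    1 + 2^-r: opening it always opens two gaps at once. *)
Lemma components_ge5 (R : realType) (r V : R) : 2 <= r ->
  V < 1 + term r 5 -> (forall n, rough 6 n -> sigma_neg r n <= V) ->
  (`I_5 #<= components (closure (sigma_neg_range r)))%card.
Proof.
move=> r2 Vc HV; have r1 : 1 <= r by rewrite (le_trans _ r2) // ler1n.
have a4 : term r 2 <= 1 / 4.
  have := @term_ratio_sqr _ r 1 2 isT r2; rewrite term1; lra.
have ba : term r 3 <= 4 / 9 * term r 2.
  have := @term_ratio_sqr _ r 2 3 isT r2; lra.
have cb : term r 5 <= 9 / 25 * term r 3.
  have := @term_ratio_sqr _ r 3 5 isT r2; lra.
have ca : term r 5 <= 16 / 25 * term r 2 ^+ 2.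
  have := @term_ratio_sqr _ r 4 5 isT r2; rewrite (@termX _ r 2 2); lra.
have a0 : 0 < term r 2 by apply: term_gt0.
have b0 : 0 < term r 3 by apply: term_gt0.
have c0 : 0 < term r 5 by apply: term_gt0.
set a := term r 2 in a4 ba ca a0 *.
set b := term r 3 in ba cb b0 *.
set c := term r 5 in Vc cb ca c0 *.
(* the supremum of the odd values is at most lo2 *)
pose lo2 := V / (1 - c) / (1 - b).
have V1 : 1 <= V by rewrite -(sigma1 r); apply: HV; exact: rough1.
have lt1 : V / (1 - c) < 1 + b.
  rewrite ltr_pdivrMr; last lra.
  nra.
have le1 : 1 + c <= V / (1 - c).
  rewrite ler_pdivlMr; last lra.
  nra.
have lt2 : lo2 < 1 + a.
  rewrite /lo2 !ltr_pdivrMr; [|lra..].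
  have h : 1 - b - c <= (1 - b) * (1 - c) by nra.
  have h' : 1 + c <= (1 + a) * (1 - b - c) by nra.
  apply: (lt_le_trans Vc); apply: (le_trans h').
  by rewrite -mulrA ler_wpM2l //; lra.
have le2 : 1 + b <= lo2.
  rewrite /lo2 ler_pdivlMr; last lra.
  by apply: le_trans le1; nra.
(* values with exponent of 2 at least 2 stay above the fourth gap *)
have aac : (1 + a) * (1 + c) <= 1 + a + a ^+ 2 by nra.
pose p := nth 0 [:: 1; 1 + c; 1 + b; 1 + a; (1 + a) * (1 + c)].
pose l := nth 0 [:: V; V / (1 - c); lo2; (1 + a) * V].
have primeS q : prime q -> sigma_neg r q = 1 + term r q.
  move=> pq; have := @sigma_pfactor _ r q 1 1 pq isT.
  rewrite expn1 muln1 sigma1 mulr1 geom_sum1; apply.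
  by rewrite dvdn1; apply: contraTneq pq => ->.
have decomp s : sigma_neg_range r s -> exists i j k w, [/\ 1 <= w, w <= V &
    s = geom_sum a i * (geom_sum b j * (geom_sum c k * w))].
  move=> [n n0 <-]; have : rough 2 n by split=> // q /prime_gt1.
  rewrite rough_prime // => -[i [m2 [_ m2r ->]]]; exists i.
  have [m20 m2n] := rough_coprime (isT : prime 2) m2r.
  rewrite sigma_pfactor //; move: m2r; rewrite rough_prime // => -[j [m3 [_ m3r
    ->]]].
  have [m30 m3n] := rough_coprime (isT : prime 3) m3r.
  exists j; rewrite sigma_pfactor //; move: m3r;
    rewrite rough_composite // rough_prime //.
  move=> -[k [m5 [_ m5r ->]]].
  have [m50 m5n] := rough_coprime (isT : prime 5) m5r.
  exists k, (sigma_neg r m5); rewrite sigma_pfactor //; split=> //;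
    first exact: sigma_ge1.
  exact: HV.
have g1 x i : 0 < x -> 1 <= geom_sum x i.
  by move=> x0; rewrite geom_sum_ge1 // ltW.
have g0 x i : 0 < x -> 0 <= geom_sum x i.
  by move=> x0; rewrite (le_trans ler01) // g1.
have gS x i : 0 < x -> 1 + x <= geom_sum x i.+1.
  by move=> x0; rewrite -geom_sum1 geom_sum_mono // ltW.
have gl x i : 0 < x -> x < 1 -> geom_sum x i <= (1 - x)^-1.
  by move=> x0 x1; apply/ltW/geom_sum_lt; rewrite x0.
have mul_ge1 (x y : R) : 1 <= x -> 1 <= y -> 1 <= x * y by move=> ? ?; nra.
have gel (x y z : R) : 1 <= y -> 0 <= x -> z <= x -> z <= x * y.
  by move=> y1 x0 zx; rewrite (le_trans zx) // ler_peMr.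
apply: (@components_ge_gaps _ _ _ p l).
  move=> [_|[_|[_|[_|[_|//]]]]] /=.
  - by exists 1%N; rewrite ?sigma1.
  - by exists 5%N; rewrite ?primeS.
  - by exists 3%N; rewrite ?primeS.
  - by exists 2%N; rewrite ?primeS.
  - exists (2 ^ 1 * 5)%N => //; rewrite sigma_pfactor // geom_sum1 primeS //.
have c1 : c < 1 by lra.
have b1 : b < 1 by lra.
have boundC k w : w <= V -> 1 <= w -> geom_sum c k * w <= V / (1 - c).
  by move=> wV w1; rewrite mulrC ler_pM ?gl ?g0 // (le_trans ler01).
have boundB j k w : w <= V -> 1 <= w ->
    geom_sum b j * (geom_sum c k * w) <= lo2.
  move=> wV w1; rewrite mulrC /lo2 ler_pM ?gl ?g0 ?boundC //.
  by rewrite (le_trans ler01) // mul_ge1 ?g1.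
move=> i i4.
suff [h1 h2 h3] : [/\ p i <= l i, l i < p i.+1 &
     forall e2 e3 e5 w, 1 <= w -> w <= V ->
     geom_sum a e2 * (geom_sum b e3 * (geom_sum c e5 * w)) <= l i \/
     p i.+1 <= geom_sum a e2 * (geom_sum b e3 * (geom_sum c e5 * w))].
  by split=> // s /decomp[e2 [e3 [e5 [w [w1 wV ->]]]]]; exact: h3.
have big5 e5 w : 1 <= w -> 1 + c <= geom_sum c e5.+1 * w.
  by move=> w1; rewrite gel ?gS ?g0.
have big3 e3 e5 w : 1 <= w -> 1 + b <= geom_sum b e3.+1 * (geom_sum c e5 * w).
  by move=> w1; rewrite gel ?gS ?g0 ?mul_ge1 ?g1.
have big2 e2 e3 e5 w : 1 <= w ->
    1 + a <= geom_sum a e2.+1 * (geom_sum b e3 * (geom_sum c e5 * w)).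
  by move=> w1; rewrite gel ?gS ?g0 ?mul_ge1 ?g1.
case: i i4 => [_|[_|[_|[_|//]]]] /=; rewrite /p /l /=; split=> //.
- move=> [|e2] [|e3] [|e5] w w1 wV; rewrite ?geom_sum0 ?mul1r.
  + by left.
  + by right; exact: big5.
  + by right; have := big3 e3 0%N w w1; rewrite geom_sum0 mul1r; lra.
  + by right; have := big3 e3 e5.+1 w w1; lra.
  + by right; have := big2 e2 0%N 0%N w w1; rewrite !geom_sum0 !mul1r; lra.
  + by right; have := big2 e2 0%N e5.+1 w w1; rewrite !geom_sum0 !mul1r; lra.
  + by right; have := big2 e2 e3.+1 0%N w w1; rewrite !geom_sum0 !mul1r; lra.
  + by right; have := big2 e2 e3.+1 e5.+1 w w1; lra.
- move=> [|e2] [|e3] e5 w w1 wV; rewrite ?geom_sum0 ?mul1r.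
  + by left; exact: boundC.
  + by right; exact: big3.
  + by right; have := big2 e2 0%N e5 w w1; rewrite !geom_sum0 !mul1r; lra.
  + by right; have := big2 e2 e3.+1 e5 w w1; lra.
- move=> [|e2] e3 e5 w w1 wV; rewrite ?geom_sum0 ?mul1r.
  + by left; exact: boundB.
  + by right; exact: big2.
- by rewrite ler_peMr // addr_ge0 // ltW.
- by rewrite ltr_pM2l // addr_gt0.
- have a10 : 0 <= 1 + a by lra.
  move=> [|[|e2]] e3 e5 w w1 wV.
  + rewrite geom_sum0 mul1r; left; apply: (le_trans (boundB _ _ _ wV w1)).
    by rewrite (le_trans (ltW lt2)) // ler_peMr.
  + rewrite geom_sum1; case: e3 e5 => [|e3] [|e5].
    * by left; rewrite !geom_sum0 !mul1r ler_wpM2l.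
    * by right; rewrite geom_sum0 mul1r ler_wpM2l // big5.
    * by right; rewrite ler_wpM2l // (le_trans _ (big3 _ _ _ w1)) //; lra.
    * by right; rewrite ler_wpM2l // (le_trans _ (big3 _ _ _ w1)) //; lra.
  + right; apply: (le_trans aac); apply: gel; rewrite ?g0 ?mul_ge1 ?g1 //.
    have -> : 1 + a + a ^+ 2 = geom_sum a 2 by rewrite geom_sumS geom_sum1.
    by apply: geom_sum_mono => //; exact: ltW.
Qed.

(** * Checking the filling condition *)

(** The exponent 7/3 separates the two regimes: the filling condition at 5
    fails from about 2.285 on, the one at 7 holds up to about 2.425.  With
    denominator 3, bounds on such powers reduce to comparing a cube with a
    seventh power. *)
Lemma powR73_cube (R : realType) (x : R) :
  0 <= x -> (x `^ (7 / 3)) ^+ 3 = x ^+ 7.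
Proof.
move=> x0; rewrite -powR_mulrn ?powR_ge0 // -powRrM -powR_mulrn //.
by congr (_ `^ _); lra.
Qed.

Lemma powR73_le (R : realType) (x c : R) : 0 <= x -> 0 <= c ->
  x ^+ 7 <= c ^+ 3 -> x `^ (7 / 3) <= c.
Proof.
move=> x0 c0 xc; rewrite -(@ler_pXn2r _ 3) ?nnegrE ?powR_ge0 //.
by rewrite powR73_cube.
Qed.

Lemma powR73_ge (R : realType) (x c : R) : 0 <= x -> 0 <= c ->
  c ^+ 3 <= x ^+ 7 -> c <= x `^ (7 / 3).
Proof.
move=> x0 c0 xc; rewrite -(@ler_pXn2r _ 3) ?nnegrE ?powR_ge0 //.
by rewrite powR73_cube.
Qed.

Lemma ler_sum_subseq (R : realType) (S Q : seq nat) (P : pred nat)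
    (f : nat -> R) :
  uniq S -> uniq Q -> {subset Q <= S} -> (forall q, q \in Q -> P q) ->
  (forall q, 0 <= f q) -> \sum_(q <- Q) f q <= \sum_(q <- S | P q) f q.
Proof.
move=> uS uQ QS QP f0; rewrite (bigID (fun q => q \in Q) P) /=.
have -> : \sum_(q <- S | P q && (q \in Q)) f q = \sum_(q <- Q) f q.
  rewrite -big_filter; apply: perm_big; apply: uniq_perm => //.
    exact: filter_uniq.
  move=> q; rewrite mem_filter.
  have [qQ|] := boolP (q \in Q); last by rewrite andbF.
  by rewrite QP // QS.
by rewrite lerDl sumr_ge0.
Qed.

(** 1/(1 - x) >= 1 + x, so the Euler product over the primes of Q exceeds
    1 + p^-r as soon as the terms of Q add up to p^-r; dividing by p^-r, it is
    enough to check this for the largest exponent considered. *)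
Lemma tail_fills_seq (R : realType) (r s : R) (p : nat) (Q : seq nat) :
  1 <= r -> r <= s -> (0 < p)%N -> uniq Q -> all prime Q -> all (ltn p) Q ->
  1 <= \sum_(q <- Q) (p%:R / q%:R : R) `^ s -> tail_fills r p.
Proof.
move=> r1 rs p0 uQ Qp Qgt sQ.
apply: (@tail_fills_sum _ _ _ (\max_(q <- Q) q).+1 r1).
have t0 := ltW (term_gt0 r p0).
apply: (@le_trans _ _ (\sum_(q <- Q) term r q)).
  apply: (@le_trans _ _ (\sum_(q <- Q) (p%:R / q%:R) `^ s * term r p)).
    by rewrite -mulr_suml ler_peMl.
  rewrite big_seq [leRHS]big_seq; apply: ler_sum => q /(allP Qgt) pq.
  by apply: term_ratio_ge => //; rewrite p0 ltnW.
apply: ler_sum_subseq => //; first exact: iota_uniq.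
- move=> q qQ; have pq : (p < q)%N := allP Qgt _ qQ.
  by rewrite mem_index_iota pq ltnS; exact: leq_bigmax_seq.
- exact/allP.
- by move=> q; exact: powR_ge0.
Qed.

(** One list of primes Q, all at least b, serves every p in [a, b), because
    (p/q)^3 grows with p. *)
Lemma tail_fills_interval (R : realType) (r : R) (a b : nat) (Q : seq nat) p :
  1 <= r -> r <= 3 -> [&& (0 < a)%N, uniq Q, all prime Q & all (leq b) Q] ->
  1 <= \sum_(q <- Q) (a%:R / q%:R : R) ^+ 3 ->
  (a <= p)%N -> (p < b)%N -> tail_fills r p.
Proof.
move=> r1 r3 /and4P[a0 uQ Qp Qb] sQ ap pb.
apply: (@tail_fills_seq _ _ 3 _ Q) => //; first exact: leq_trans ap.
  by apply: sub_all Qb => q; exact: leq_trans.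
apply: le_trans sQ _; rewrite big_seq [leRHS]big_seq; apply: ler_sum => q qQ.
rewrite (@powR_mulrn _ _ 3) ?divr_ge0 // lerXn2r ?nnegrE ?divr_ge0 //.
by rewrite ler_wpM2r ?invr_ge0 // ler_nat.
Qed.

Lemma tail_fills_mid (R : realType) (r : R) (p : nat) : 1 <= r -> r <= 3 ->
  (11 <= p < 4096)%N -> tail_fills r p.
Proof.
move=> r1 r3 /andP[p11 p4096].
have fills a b Q := @tail_fills_interval R r a b Q p r1 r3.
have [?|?] := ltnP p 13.
  apply: (fills 11 13 [:: 13; 17; 19]%N); [by vm_compute| |exact|exact].
  by rewrite !big_cons big_nil; clear; lra.
have [?|?] := ltnP p 17.
  apply: (fills 13 17 [:: 17; 19; 23; 29]%N); [by vm_compute| |exact|exact].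
  by rewrite !big_cons big_nil; clear; lra.
have [?|?] := ltnP p 23.
  apply: (fills 17 23 [:: 23; 29; 31; 37; 41; 43; 47]%N);
    [by vm_compute| |exact|exact].
  by rewrite !big_cons big_nil; clear; lra.
have [?|?] := ltnP p 37.
  apply: (fills 23 37 [:: 37; 41; 43; 47; 53; 59; 61; 67; 71; 73; 79]%N);
    [by vm_compute| |exact|exact].
  by rewrite !big_cons big_nil; clear; lra.
have [?|?] := ltnP p 61.
  apply: (fills 37 61 [:: 61; 67; 71; 73; 79; 83; 89; 97; 101]%N);
    [by vm_compute| |exact|exact].
  by rewrite !big_cons big_nil; clear; lra.
have [?|?] := ltnP p 109.
  apply: (fills 61 109 [:: 109; 113; 127; 131; 137; 139; 149; 151; 157; 163;
    167]%N); [by vm_compute| |exact|exact].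
  by rewrite !big_cons big_nil; clear; lra.
have [?|?] := ltnP p 223.
  apply: (fills 109 223 [:: 223; 227; 229; 233; 239; 241; 251; 257; 263; 269;
    271; 277]%N); [by vm_compute| |exact|exact].
  by rewrite !big_cons big_nil; clear; lra.
have [?|?] := ltnP p 467.
  apply: (fills 223 467 [:: 467; 479; 487; 491; 499; 503; 509; 521; 523; 541;
    547; 557]%N); [by vm_compute| |exact|exact].
  by rewrite !big_cons big_nil; clear; lra.
have [?|?] := ltnP p 1033.
  apply: (fills 467 1033 [:: 1033; 1039; 1049; 1051; 1061; 1063; 1069; 1087;
    1091; 1093; 1097; 1103]%N); [by vm_compute| |exact|exact].
  by rewrite !big_cons big_nil; clear; lra.
have [?|?] := ltnP p 2333.
  apply: (fills 1033 2333 [:: 2333; 2339; 2341; 2347; 2351; 2357; 2371; 2377;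
    2381; 2383; 2389; 2393]%N); [by vm_compute| |exact|exact].
  by rewrite !big_cons big_nil; clear; lra.
apply: (fills 2333 4096 [:: 4099; 4111; 4127; 4129; 4133; 4139]%N);
  [by vm_compute| |exact|exact].
  by rewrite !big_cons big_nil; clear; lra.
Qed.

Lemma tail_fills_large (R : realType) (r : R) (p : nat) : 1 <= r -> r <= 3 ->
  (4096 <= p)%N -> tail_fills r p.
Proof.
move=> r1 r3 p4096; have p0 : (0 < p)%N by apply: leq_trans p4096.
apply: (@tail_fills_sum _ _ _ (4 * p).+1 r1).
have t0 := term_gt0 r p0.
apply: (@le_trans _ _ (\sum_(p.+1 <= q < (4 * p).+1 | prime q) term r p / 64)).
  rewrite big_const_seq iter_addr_0 -sum1_count -(mulr_natl (term r p / 64)).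
  have := many_primes_window p4096; rewrite -(ler_nat R) => h.
  by rewrite mulrCA ler_peMr ?(ltW t0) //; lra.
rewrite big_nat_cond [leRHS]big_nat_cond.
apply: ler_sum => q /andP[/andP[pq q4] _].
have ppq : (0 < p <= q)%N by rewrite p0 ltnW.
apply: le_trans (term_ratio_ge ppq r3).
rewrite mulrC ler_wpM2r ?(ltW t0) // (@powR_mulrn _ _ 3) ?divr_ge0 //.
have -> : 64^-1 = (1 / 4 : R) ^+ 3 by lra.
rewrite lerXn2r ?nnegrE ?divr_ge0 //.
have q0 : (0 < q)%N by apply: leq_trans pq.
by rewrite ler_pdivlMr ?ltr0n // mulrAC ler_pdivrMr // mul1r -natrM ler_nat
  mulnC -ltnS.
Qed.

(** The sum of (7/q)^3 stays below 1, so the exponent 3 is too large here; L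
    lists, for each prime q used, a lower bound of (7/q)^(7/3) in units of
    10^-4. *)
Lemma tail_fills7 (R : realType) (r : R) :
  1 <= r -> r <= 7 / 3 -> tail_fills r 7.
Proof.
move=> r1 r73.
apply: (@tail_fills_seq _ _ _ _ [:: 11; 13; 17; 19; 23; 29; 31; 37; 41; 43; 47;
  53; 59; 61]%N r1 r73) => //.
pose L := [::
  (11, 3483); (13, 2358); (17, 1261); (19, 973); (23, 623); (29, 362);
  (31, 310); (37, 205); (41, 161); (43, 144); (47, 117); (53, 88); (59, 69);
  (61, 63)]%N.
apply: (@le_trans _ _ (\sum_(qc <- L) qc.2%:R / 100 / 100)).
  by rewrite !big_cons big_nil /=; clear; lra.
rewrite !big_cons !big_nil /=.
do 14! (apply: lerD; first by apply: powR73_ge; clear; lra).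
by [].
Qed.

Lemma tail_fills5 (R : realType) (r : R) : 1 <= r -> r <= 2 -> tail_fills r 5.
Proof.
move=> r1 r2; apply: (@tail_fills_seq _ _ _ _ [:: 7; 11; 13; 17; 19]%N
  r1 r2) => //.
by rewrite !big_cons big_nil !(@powR_mulrn _ _ 2) ?divr_ge0 //; lra.
Qed.

(** * Failure of the filling condition at 5 beyond 7/3 *)

Definition ratio73 (R : realType) (d : nat) : R := (5 / d%:R) `^ (7 / 3).

(** L lists an upper bound of (5/d)^(7/3) in units of 10^-4 for each d. *)
Lemma ratio73_head (R : realType) :
  \sum_(7 <= d < 150 | coprime d 30) ratio73 R d <= 952 / 1000.
Proof.
pose L := [::
  (7, 4561); (11, 1589); (13, 1076); (17, 576); (19, 444); (23, 285); (29, 166);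
  (31, 142); (37, 94); (41, 74); (43, 66); (47, 54); (49, 49); (53, 41);
  (59, 32); (61, 30); (67, 24); (71, 21); (73, 20); (77, 17); (79, 16);
  (83, 15); (89, 13); (91, 12); (97, 10); (101, 9); (103, 9); (107, 8);
  (109, 8); (113, 7); (119, 7); (121, 6); (127, 6); (131, 5); (133, 5);
  (137, 5); (139, 5); (143, 4); (149, 4)]%N.
rewrite -big_filter.
have -> : [seq d <- index_iota 7 150 | coprime d 30] = map fst L by vm_compute.
rewrite big_map; apply: (@le_trans _ _ (\sum_(dc <- L) dc.2%:R / 100 / 100)).
  rewrite !big_cons !big_nil /=.
  do 39! (apply: lerD; first by apply: powR73_le; clear; lra).
  by [].
by rewrite !big_cons big_nil /=; clear; lra.
Qed.

(** For d >= 150 the weight (5/d)^(7/3) is at most 8.05/d^2, because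
    5^7/150 <= 8.05^3.  Only odd d are coprime to 30, and for those 1/d^2 is
    bounded by a difference of the telescoping function 1/(4 floor(d/2)),
    which is constant from even d to d+1. *)
Lemma ratio73_tail (R : realType) (M : nat) :
  \sum_(150 <= d < M | coprime d 30) ratio73 R d <= 27 / 1000.
Proof.
pose h (d : nat) : R := 1 / 4 / (d./2)%:R.
have h0 d : 0 <= h d by rewrite /h !divr_ge0.
have h150 : h 150%N = 1 / 300.
  rewrite /h; have -> : (150./2 = 75)%N by [].
  by clear; lra.
suff : (150 <= M)%N ->
    \sum_(150 <= d < M | coprime d 30) ratio73 R d <= 805 / 100 * (h 150%N - h
      M).
  move=> H; have [M150|/H {}H] := ltnP M 150.
    by rewrite big_geq; [clear; lra|exact: ltnW].
  by apply: le_trans H _; have := h0 M; rewrite h150; clear; lra.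
elim: M => // M IHM; rewrite leq_eqVlt => /orP[/eqP <-|].
  by rewrite subrr mulr0; rewrite big_geq; [exact: lexx|exact: leqnn].
rewrite ltnS => M150; rewrite big_mkcond big_nat_recr //= -big_mkcond /=.
suff step : (if coprime M 30 then ratio73 R M else 0) <= 805 / 100 * (h M - h
  M.+1).
  by have := IHM M150; move: step; set S := \sum_(_ <= _ < _ | _) _; clear; lra.
have j0 : (0 < M./2)%N by clear -M150; lia.
have j0R : 1 <= (M./2)%:R :> R by rewrite ler1n.
have [oM|eM] := boolP (odd M); last first.
  rewrite ifF; last first.
    apply/negbTE; rewrite (_ : 30 = 2 * 15)%N // coprimeMr negb_and coprime_sym
      prime_coprime //.
    by rewrite negbK dvdn2 eM.
  by rewrite /h /= uphalf_half (negbTE eM) add0n subrr mulr0.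
have eM : M%:R = 1 + 2 * (M./2)%:R :> R.
  by rewrite -{1}(odd_double_half M) oM natrD -mul2n natrM.
have hh : M%:R ^- 2 <= h M - h M.+1.
  rewrite /h /= uphalf_half oM add1n -[(M./2).+1%:R]natr1 eM.
  move: (M./2)%:R j0R => x x1; clear -x1.
  rewrite -subr_ge0.
  have -> : 1 / 4 / x - 1 / 4 / (x + 1) - (1 + 2 * x) ^- 2 =
    1 / (4 * x * (x + 1) * (1 + 2 * x) ^+ 2) by field; lra.
  by rewrite divr_ge0 // !mulr_ge0 ?exprn_ge0 //; lra.
case: ifP => _; last first.
  apply: mulr_ge0; first by clear; lra.
  by apply: le_trans hh; rewrite invr_ge0 exprn_ge0.
apply: (@le_trans _ _ (805 / 100 * M%:R ^- 2)); last first.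
  by apply: ler_wpM2l; [clear; lra|exact: hh].
have M150R : 150 <= M%:R :> R by rewrite (ler_nat R 150 M).
rewrite /ratio73; move: M%:R M150R => x; clear => x150.
have x0 : 0 < x by lra.
have u0 : 0 < x^-1 by rewrite invr_gt0.
have u1 : x^-1 <= 1 / 150 by rewrite div1r lef_pV2 ?posrE; lra.
rewrite -exprVn; move: x^-1 u0 u1 => u; clear => u0 u1.
apply: powR73_le; [by lra|apply: mulr_ge0; [by clear;
  lra|by rewrite exprn_ge0 // ltW]|].
have -> : (5 * u) ^+ 7 = u ^+ 6 * (5 ^+ 7 * u) by ring.
have -> : (805 / 100 * u ^+ 2) ^+ 3 = u ^+ 6 * (805 / 100) ^+ 3 by field.
by apply: ler_wpM2l; [rewrite exprn_ge0 // ltW|lra].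
Qed.

Lemma rough6_dvd n d : rough 6 n -> (d %| n)%N -> d != 1%N ->
  (7 <= d)%N && coprime d 30.
Proof.
move=> [n0 H] dn d1; have d0 : (0 < d)%N by apply: dvdn_gt0 dn.
have nd p : prime p -> (p < 6)%N -> ~~ (p %| d)%N.
  by move=> pp p6; apply/negP => pd; have := H p pp (dvdn_trans pd dn); lia.
have c2 : coprime d 2 by rewrite coprime_sym prime_coprime // nd.
have c3 : coprime d 3 by rewrite coprime_sym prime_coprime // nd.
have c5 : coprime d 5 by rewrite coprime_sym prime_coprime // nd.
rewrite (_ : 30 = 2 * (3 * 5))%N // !coprimeMr c2 c3 c5 !andbT.
move: d d0 d1 c2 c3 c5 {dn nd}; do 7! (case=> //).
Qed.

(** The divisors of a 6-rough integer other than 1 are at least 7 and coprime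
    to 30; the sum of (5/d)^r over all such d decreases in r, and it is below
    0.98 at r = 7/3. *)
Lemma sigma_rough6_le (R : realType) (r : R) n : 7 / 3 <= r -> rough 6 n ->
  sigma_neg r n <= 1 + 98 / 100 * term r 5.
Proof.
move=> r73 n6; have c0 := term_gt0 r (isT : 0 < 5)%N.
have n0 := n6.1.
rewrite /sigma_neg (perm_big _ (perm_to_rem (divisor1 n))) big_cons.
rewrite -/(term r 1) term1 lerD2l.
have uR := rem_uniq 1%N (divisors_uniq n).
have Rd d : d \in rem 1%N (divisors n) ->
    (7 <= d)%N && coprime d 30 /\ (d <= n)%N.
  rewrite mem_rem_uniq ?divisors_uniq // inE -dvdn_divisors // => /andP[d1 dn].
  by split; [exact: rough6_dvd dn d1|exact: dvdn_leq].
apply: (@le_trans _ _ (\sum_(d <- rem 1%N (divisors n)) ratio73 R d * term r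
  5)).
  rewrite big_seq [leRHS]big_seq; apply: ler_sum => d /Rd[/andP[d7 _] _].
  by apply: term_ratio_le => //=; apply: leq_trans d7.
rewrite -mulr_suml ler_wpM2r ?(ltW c0) //.
apply: (@le_trans _ _ (\sum_(7 <= d < n.+1 + 150 | coprime d 30) ratio73 R d)).
  apply: ler_sum_subseq => //; first exact: iota_uniq.
  - move=> d /Rd[/andP[d7 _] dn]; rewrite mem_index_iota d7 /=; lia.
  - by move=> d /Rd[/andP[]].
  - by move=> d; exact: powR_ge0.
rewrite (@big_cat_nat _ _ _ 150) //=; last by lia.
by have := ratio73_head R; have := ratio73_tail R (n.+1 + 150); lra.
Qed.

(** * Conclusion *)

Lemma tail_fills_ge5 (R : realType) (r : R) (p : nat) :
  1 <= r -> r <= 7 / 3 -> tail_fills r 5 -> prime p -> (5 <= p)%N ->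
  tail_fills r p.
Proof.
move=> r1 r73 fill5 pp p5; have r3 : r <= 3 by lra.
have [p4096|p4096] := leqP 4096 p; first exact: tail_fills_large.
have [p11|p11] := leqP 11 p; first by apply: tail_fills_mid; rewrite ?p11.
move: p p5 p11 pp {p4096} => [|[|[|[|[|[|[|[|[|[|[|]]]]]]]]]]] // _ _ _.
exact: tail_fills7.
Qed.

Theorem theorem4p1 (R : realType) (r : R) (hr : 1 <= r) :
  ~ (components (closure (sigma_neg_range r)) #= `I_4)%card.
Proof.
rewrite card_eq_le => /andP[C4 C4'].
have few : ~ (components (closure (sigma_neg_range r)) #<= `I_3)%card.
  by move=> C3; have := card_le_trans C4' C3; rewrite card_le_II.
have many : ~ (`I_5 #<= components (closure (sigma_neg_range r)))%card.
  by move=> C5; have := card_le_trans C5 C4; rewrite card_le_II.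
have c0 := term_gt0 r (isT : 0 < 5)%N.
have [r73|r73] := leP r (7 / 3); last first.
  apply: many; apply: (@components_ge5 _ _ (1 + 98 / 100 * term r 5)).
  - by lra.
  - by lra.
  - by move=> n; apply: sigma_rough6_le; exact: ltW.
have [fill5|nfill5] := pselect (tail_fills r 5).
  have y0 := term_gt0 r (isT : 0 < 3)%N.
  have z0 := term_gt0 r (isT : 0 < 4)%N.
  have h45 : 1 / 2 <= (4 / 5 : R) `^ (7 / 3) by apply: powR73_ge; clear; lra.
  have h34 : 1 / 2 <= (3 / 4 : R) `^ (7 / 3) by apply: powR73_ge; clear; lra.
  have h35 : 1 / 4 <= (3 / 5 : R) `^ (7 / 3) by apply: powR73_ge; clear; lra.
  have t45 := @term_ratio_ge _ _ _ 4 5 isT r73.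
  have t34 := @term_ratio_ge _ _ _ 3 4 isT r73.
  have t35 := @term_ratio_ge _ _ _ 3 5 isT r73.
  have e4 : term r 2 ^+ 2 = term r 4 by rewrite -termX.
  apply: few; apply: components_le3 => //.
  - by move=> p; exact: tail_fills_ge5.
  - by rewrite e4; nra.
  - by rewrite e4; nra.
have r2 : 2 <= r.
  by have [//|/ltW r2] := leP 2 r; case: nfill5; exact: tail_fills5.
have [V Vc HV] : exists2 V, V < 1 + term r 5 & forall M, euler_prod r 6 M <= V.
  apply: contrapT => noV; apply: nfill5 => v vc.
  apply: contrapT => noM; apply: noV; exists v => // M.
  by rewrite leNgt; apply/negP => vM; apply: noM; exists M.
apply: many; apply: (@components_ge5 _ _ V) => // n n6.
by have [M _ hM] := sigma_le_some_euler_prod 0 hr n6; exact: le_trans hM (HV M).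
Qed.
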